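(* Let $\sigma=(\sigma_i)_{i\ge0}\in\{0,1\}^{\mathbb N_0}$ and $h_n=2^{\sum_{i=0}^{n-1}\sigma_i}$, $n\ge1$. Then $(h_n)$ is a scaling sequence of the dyadic filtration $\zeta=(\zeta_n)_{n\ge0}$ on $(I^{\mathcal D}\times I^{\mathbb N},\omega^\sigma)$, and also of the tail filtration $\xi=(\xi_n)_{n\ge0}$ on $(\mathcal T(\mathrm{OP}),\mu^\sigma)$, which is isomorphic to $\zeta$.
   Context: $I=\{0,1\}$; $\mathcal D=\bigoplus_{i\ge0}\mathbb Z/2\mathbb Z$ with generators $g_0,g_1,\dots$, $\mathcal D_n=\langle g_0,\dots,g_{n-1}\rangle$. $I^{\mathbb N}$ is the group of $0$–$1$ sequences $(\alpha_i)_{i\ge1}$ (addition mod 2) with uniform Bernoulli measure $m$; $\tau(\sum_i\alpha_ig_{i-1})=(\alpha_i)_{i\ge1}$. $\operatorname{diag}(g)(w,\alpha)=(w(\cdot+g),\alpha+\tau(g))$ is a free action on $I^{\mathcal D}\times I^{\mathbb N}$; $\zeta_n$ is the partition into $\operatorname{diag}(\mathcal D_n)$-orbits. Let $\mathcal D^\sigma=\langle g_i:\sigma_i=0\rangle$; $m^\sigma$ is the law on $I^{\mathcal D}$ of a random configuration constant on cosets of $\mathcal D^\sigma$ with independent uniform values on distinct cosets; $\omega^\sigma=m^\sigma\times m$. The graph $\mathrm{OP}$: $\mathrm{OP}_0=I$, $\mathrm{OP}_{n+1}=\mathrm{OP}_n\times\mathrm{OP}_n$, with an index-0 edge from $v_0$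 and an index-1 edge from $v_1$ to each $v=(v_0,v_1)$; $\mathcal T(\mathrm{OP})$ is its space of infinite paths from floor 0; $\xi_n$ is the partition into classes of paths coinciding from floor $n$ on. There is a homeomorphism $\Psi\colon\mathcal T(\mathrm{OP})\to I^{\mathcal D}\times I^{\mathbb N}$ mapping $\xi_n$ to $\zeta_n$ for all $n$ (explicitly: $\Psi[x]=(F[x],\alpha)$ where $\alpha_n$ is the index of the $(n-1)$-th edge of $x$ and $F[x](g)=\Phi[v_n](g+\sum_{i<n}\alpha_{i+1}g_i)$ for $g\in\mathcal D_n$, with $\Phi$ labelling floor-$n$ vertices by configurations on $\mathcal D_n$ recursively via $\Phi[(v_0,v_1)](h)=\Phi[v_0](h)$ on $\mathcal D_n$, $=\Phi[v_1](g_n+h)$ on $\mathcal D_{n+1}\setminus\mathcal D_n$); $\mu^\sigma=\Psi^{-1}_*\omega^\sigma$. A dyadic filtration is a sequence of measurable partitions $\varsigma_0\succ\varsigma_1\succ\dots$ with $\varsigma_0$ the partition into points and each element of $\varsigma_{n+1}$ the union of two elements of $\varsigma_n$. Kantorovich iteration: $\mathcal K_n[\rho](c_1,c_2)=\min_s 2^{-n}\sum_{x\in c_1}\rho(x,s(x))$ for $c_1,c_2\in\varsigma_n$, over bijections $s\colon c_1\to c_2$ mapping, for each $j<n$, elements of $\varsigma_j$ in $c_1$ onto elements of $\varsigma_j$ in $c_2$. $\mathbb H_\varepsilon(Y,\nu,d)$ is the binary logarithm of the least $k$ with a measurable partition $Y_0,\dots,Y_k$, $\nu(Y_0)<\varepsilon$,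 $\operatorname{diam}_dY_j<\varepsilon$ ($j\ge1$). A positive sequence $h$ is a scaling sequence of the filtration $\varsigma$ on $(X,\mu)$ if for some (equivalently every) summable admissible metric $\rho$ (measurable on $X^2$, in $L^1(\mu^2)$, a separable metric on a set of full measure) and all sufficiently small $\varepsilon>0$, $\mathbb H_\varepsilon(X/\varsigma_n,\mu/\varsigma_n,\mathcal K_n[\rho])\asymp h_n$, where $a_n\asymp b_n$ means $0<\liminf a_n/b_n\le\limsup a_n/b_n<\infty$. *)

(* Defs.v *)
From HB Require Import structures.
From mathcomp Require Import all_boot all_order all_algebra.
From mathcomp Require Import all_classical all_reals all_analysis.
Set Implicit Arguments. Unset Strict Implicit. Unset Printing Implicit Defensive.
Import Order.TTheory GRing.Theory Num.Theory.
Local Open Scope classical_set_scope.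
Local Open Scope ring_scope.

(* A filtration is given as a family of equivalence relations S n :    *)
(* S n x is the element of varsigma_n containing x.                   *)

Section Generic.
Context {d : measure_display} {T : measurableType d} {R : realType}.

Definition Kant (S : nat -> T -> T -> Prop) (rho : T -> T -> R) (n : nat)
    (x y : T) : \bar R :=
  ereal_inf [set ((2%:R ^+ n)^-1 * \sum_(z \in S n x) rho z (s z))%:E
            | s in [set s : T -> T | set_bij (S n x) (S n y) s /\
                (forall j, (j < n)%N -> forall z, S n x z ->
                   s @` (S j z) = S j (s z))]].

Definition Kdiam (S : nat -> T -> T -> Prop) (rho : T -> T -> R) (n : nat)
    (Y : set T) : \bar R :=
  ereal_sup [set r | exists x y, Y x /\ Y y /\ r = Kant S rho n x y].

(* k such that there is a measurable partition Y_0, ..., Y_k of X/varsigma_n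
   (i.e. of X into varsigma_n-saturated measurable sets) with
   mu(Y_0) < eps and diam Y_j < eps for 1 <= j <= k *)
Definition eps_partition (mu : set T -> \bar R) (S : nat -> T -> T -> Prop)
    (rho : T -> T -> R) (eps : R) (n k : nat) : Prop :=
  exists Y : nat -> set T,
    (forall j, (j <= k)%N -> measurable (Y j) /\
        (forall x y, S n x y -> Y j x -> Y j y)) /\
    (forall i j, (i <= k)%N -> (j <= k)%N -> i <> j -> Y i `&` Y j = set0) /\
    \bigcup_(j in [set j | (j <= k)%N]) Y j = setT /\
    (mu (Y 0%N) < eps%:E)%E /\
    (forall j, (1 <= j <= k)%N -> (Kdiam S rho n (Y j) < eps%:E)%E).

(* H_eps(X/varsigma_n, mu/varsigma_n, K_n[rho]) = log_2 (least such k);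
   +oo if there is no such k *)
Definition entropy (mu : set T -> \bar R) (S : nat -> T -> T -> Prop)
    (rho : T -> T -> R) (eps : R) (n : nat) : \bar R :=
  match ereal_inf [set (k%:R)%:E | k in [set k | eps_partition mu S rho eps n k]]
  with
  | EFin r => (ln r / ln 2)%:E
  | _ => +oo%E
  end.

Definition asymp (a : nat -> \bar R) (b : nat -> R) : Prop :=
  (0 < limn_einf (fun n => a n * (b n)^-1%:E))%E /\
  (limn_esup (fun n => a n * (b n)^-1%:E) < +oo)%E.

Definition admissible (mu : probability T R) (rho : T -> T -> R) : Prop :=
  measurable_fun setT (fun z : T * T => rho z.1 z.2) /\
  (mu \x mu)%E.-integrable setT (fun z : T * T => (rho z.1 z.2)%:E) /\
  exists A : set T, measurable A /\ mu (~` A) = 0%E /\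
    (forall x y, A x -> A y -> (rho x y = 0 <-> x = y)) /\
    (forall x y, A x -> A y -> rho x y = rho y x) /\
    (forall x y z, A x -> A y -> A z -> rho x z <= rho x y + rho y z) /\
    (exists D : set T, D `<=` A /\ countable D /\
       forall x, A x -> forall e, 0 < e -> exists2 t, D t & rho x t < e).

Definition scaling_sequence (mu : probability T R) (S : nat -> T -> T -> Prop)
    (h : nat -> R) : Prop :=
  exists rho, admissible mu rho /\
  exists eps0 : R, 0 < eps0 /\
    forall eps, 0 < eps < eps0 -> asymp (fun n => entropy mu S rho eps n) h.

End Generic.

(* The space I^D x I^N.  D = (+)_{i>=0} Z/2 is encoded as nat with     *)
(* bitwise xor: g_i = 2^i, D_n = {g | g < 2^n}.  The sequence          *)
(* (alpha_i)_{i>=1} is encoded as a : nat -> bool with a i = alpha_{i+1}. *)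

Definition Xbase := ((nat -> bool) * (nat -> bool))%type.

Definition GX : set (set Xbase) :=
  [set A | (exists k b, A = [set x | x.1 k = b]) \/
           (exists i b, A = [set x | x.2 i = b])].

Definition Xm := g_sigma_algebraType GX.

Definition diag (g : nat) (x : Xm) : Xm :=
  (fun k => x.1 (Nat.lxor k g), fun i => xorb (x.2 i) (Nat.testbit g i)).

Definition zeta (n : nat) (x y : Xm) : Prop :=
  exists g, (g < 2 ^ n)%N /\ y = diag g x.

(* k and k' lie in the same coset of D^sigma = <g_i : sigma_i = 0> *)
Definition same_coset (sigma : nat -> bool) (k k' : nat) : Prop :=
  forall i, Nat.testbit (Nat.lxor k k') i = true -> sigma i = false.

(* a key identifying the coset of k mod D^sigma (the bits of k at
   positions i with sigma_i = 1; k has no bits beyond position k) *)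
Definition coset_key (sigma : nat -> bool) (k : nat) : seq nat :=
  [seq i <- iota 0 k.+1 | Nat.testbit k i && sigma i].

(* omega^sigma = m^sigma x m, characterized on cylinder sets *)
Definition omega_sigma (R : realType) (sigma : nat -> bool)
    (P : probability Xm R) : Prop :=
  forall (K J : seq nat) (f g : nat -> bool),
    P [set x : Xm | (forall k, k \in K -> x.1 k = f k) /\
                    (forall j, j \in J -> x.2 j = g j)] =
    if `[< forall k k', k \in K -> k' \in K -> same_coset sigma k k' ->
                        f k = f k' >]
    then ((2%:R ^+ (size (undup (map (coset_key sigma) K)) + size (undup J)))^-1)%:E
    else 0%E.

Fixpoint OP (n : nat) : Type :=
  match n with 0 => bool | m.+1 => (OP m * OP m)%type end.

(* An infinite path: vertices tv n on floor n, and te n = index of the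
   n-th edge (from floor n to floor n+1): tv n is component (te n) of
   tv (n+1). *)
Record TOP := mkTOP {
  tv : forall n, OP n;
  te : nat -> bool;
  tpath : forall n, tv n = if te n then (tv n.+1).2 else (tv n.+1).1 }.

Fixpoint OPfalse (n : nat) : OP n :=
  match n return OP n with 0 => false | m.+1 => (OPfalse m, OPfalse m) end.

Definition TOPpoint : TOP := @mkTOP OPfalse (fun _ => false) (fun _ => erefl).

HB.instance Definition _ := gen_eqMixin TOP.
HB.instance Definition _ : hasChoice TOP := gen_choiceMixin TOP.
HB.instance Definition _ := isPointed.Build TOP TOPpoint.

Definition GT : set (set TOP) :=
  [set A | (exists n (v : OP n), A = [set x | tv x n = v]) \/
           (exists n b, A = [set x | te x n = b])].

Definition Tm := g_sigma_algebraType GT.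

Definition xi (n : nat) (x y : Tm) : Prop :=
  (forall m, (n <= m)%N -> tv x m = tv y m) /\
  (forall m, (n <= m)%N -> te x m = te y m).

(* Phi : labelling of floor-n vertices by configurations on D_n *)
Fixpoint Phi (n : nat) : OP n -> nat -> bool :=
  match n return OP n -> nat -> bool with
  | 0 => fun v _ => v
  | m.+1 => fun v h => if (h < 2 ^ m)%N then @Phi m v.1 h
                       else @Phi m v.2 (Nat.lxor (2 ^ m) h)
  end.

Definition tshift (x : TOP) (n : nat) : nat := (\sum_(i < n) te x i * 2 ^ i)%N.

(* Psi[x] = (F[x], alpha); F[x](g) is computed on floor n = g (g \in D_g) *)
Definition Psi (x : Tm) : Xm :=
  (fun g => Phi (tv x g) (Nat.lxor g (tshift x g)), te x).

(* Main.v *)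
Require Import Defs.
From HB Require Import structures.
From Stdlib Require Import PeanoNat.
From mathcomp Require Import all_boot all_order all_algebra.
From mathcomp Require Import all_classical all_reals all_analysis.
From mathcomp Require Import measurable_realfun.
From mathcomp Require Import zify ring lra.
Import Order.TTheory GRing.Theory Num.Theory.
Set Implicit Arguments. Unset Strict Implicit. Unset Printing Implicit Defensive.

(* The metric is the ultrametric with value [2 ^ - N] at two points whose coordinates (the
   configuration on [D_N] and the first [N] digits) first differ at level [N].

   Lower bound. A bijection of [zeta_n]-classes compatible with the finer classes is an isomorphism
   of binary trees, and the metric is [1] where the configurations differ at [0]; hence [K_n]
   dominates the normalized Hamming distance of configurations on [D_n], minimised over tree
   automorphisms. With [m] ones among [sigma_0, ..., sigma_(n-1)], almost every configuration on
   [D_n] is one of [2 ^ 2 ^ m] configurations of probability [2 ^ - 2 ^ m], indexed by the trees of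
   depth [m], and their distances are those of the trees. The sums [G u = \sum_v t ^ dist u v]
   satisfy [G (u1, u2) <= 2 * G u1 * G u2]. As [2 * G] can exceed the number of trees at depths
   0 and 1, the recursion starts at depth 2; at [t = (3 / 4) ^ 16] it bounds the number of trees
   in a ball of radius [1 / 64] by [11 ^ 2 ^ (m - 2) / 2], exponentially smaller in [2 ^ m] than
   their total number [16 ^ 2 ^ (m - 2)].

   Upper bound. Each [zeta_n]-class has a unique point whose first [n] digits vanish. If these
   points of two classes carry the same configuration on [D_n], the equivariant bijection between
   the classes shows that their distance is at most [2 ^ - n]; so [2 ^ 2 ^ m] sets suffice.

   Scaling sequences are invariant under isomorphism, and [Psi] carries [xi] to [zeta]. *)

(** * Binary digits *)

Local Notation "a (^) b" := (Nat.lxor a b) (at level 50, left associativity).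

Lemma lxorA : associative Nat.lxor.
Proof. by move=> a b c; rewrite Nat.lxor_assoc. Qed.

Lemma lxorC : commutative Nat.lxor.
Proof. exact: Nat.lxor_comm. Qed.

Lemma lxorAC : right_commutative Nat.lxor.
Proof. by move=> a b c; rewrite -lxorA (lxorC b) lxorA. Qed.

Lemma lxorK a b : a (^) b (^) b = a.
Proof. by rewrite -lxorA Nat.lxor_nilpotent Nat.lxor_0_r. Qed.

Lemma expn_pow m n : m ^ n = Nat.pow m n.
Proof. by elim: n => // n IH; rewrite expnS IH. Qed.

Lemma testbit_exp2 n i : Nat.testbit (2 ^ n) i = (n == i).
Proof.
rewrite expn_pow Nat.pow2_bits_eqb.
by case: (eqVneq n i) => [->|/eqP neq]; [rewrite Nat.eqb_refl | apply/Nat.eqb_neq].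
Qed.

Lemma testbit_above g n i : g < 2 ^ n -> n <= i -> Nat.testbit g i = false.
Proof.
rewrite expn_pow => /ssrnat.ltP/Nat.mod_small <- /ssrnat.leP.
exact: Nat.mod_pow2_bits_high.
Qed.

Lemma testbit_leq k i : Nat.testbit k i -> i <= k.
Proof.
apply: contraTT; rewrite -ltnNge => ki.
by rewrite (@testbit_above k i) // (ltn_trans ki) // ltn_expl.
Qed.

Lemma ltn_exp2_bits g n : (forall i, n <= i -> Nat.testbit g i = false) -> g < 2 ^ n.
Proof.
move=> high; have nz : Nat.pow 2 n <> 0 by apply: Nat.pow_nonzero.
suff -> : g = Nat.modulo g (Nat.pow 2 n).
  by rewrite expn_pow; apply/ssrnat.ltP/Nat.mod_upper_bound.
apply: Nat.bits_inj => i; case: (ltnP i n) => [/ssrnat.ltP|/[dup] /ssrnat.leP] ni.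
  by rewrite Nat.mod_pow2_bits_low.
by move=> /high ->; rewrite Nat.mod_pow2_bits_high.
Qed.

Lemma ltn_exp2S g n : g < 2 ^ n -> g < 2 ^ n.+1.
Proof. by move/ltn_trans; apply; rewrite ltn_exp2l. Qed.

Lemma lxor_ltn_exp2 n a b : a < 2 ^ n -> b < 2 ^ n -> a (^) b < 2 ^ n.
Proof.
by move=> an bn; apply: ltn_exp2_bits => i ni; rewrite Nat.lxor_spec !(@testbit_above _ n).
Qed.

Lemma lxor_exp2_ltn n a : a < 2 ^ n -> a (^) 2 ^ n < 2 ^ n.+1.
Proof. by move=> an; apply: lxor_ltn_exp2; [exact: ltn_exp2S | rewrite ltn_exp2l]. Qed.

Lemma addn_exp2 n a : a < 2 ^ n -> a + 2 ^ n = a (^) 2 ^ n.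
Proof.
move=> an; apply: Nat.add_nocarry_lxor; apply: Nat.bits_inj => i.
rewrite Nat.land_spec testbit_exp2 Nat.bits_0.
by case: eqP => [<-|]; rewrite ?andbF // (testbit_above an).
Qed.

Lemma ltn_exp2SP g n : g < 2 ^ n.+1 ->
  g < 2 ^ n \/ exists2 h, h < 2 ^ n & g = h (^) 2 ^ n.
Proof.
move=> gn; case: (ltnP g (2 ^ n)) => [|ng]; [by left | right].
have hn : g - 2 ^ n < 2 ^ n by move: gn; rewrite expnS; lia.
by exists (g - 2 ^ n) => //; rewrite -addn_exp2 // subnK.
Qed.

Lemma big_exp2S (R : Type) (idx : R) (op : Monoid.law idx) n (F : nat -> R) :
  \big[op/idx]_(g < 2 ^ n.+1) F g =
  op (\big[op/idx]_(g < 2 ^ n) F g) (\big[op/idx]_(g < 2 ^ n) F (g (^) 2 ^ n)).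
Proof.
rewrite -!(big_mkord xpredT F) (big_cat_nat _ (n := 2 ^ n)) ?leq_exp2l //=.
congr (op _ _); rewrite -{1}[2 ^ n]add0n big_addn expnS mul2n -addnn addnK big_mkord.
by apply: eq_bigr => g _; rewrite addn_exp2.
Qed.

Definition nat_of_bits (a : nat -> bool) (n : nat) : nat := \sum_(i < n) a i * 2 ^ i.

Lemma nat_of_bits_ltn a n : nat_of_bits a n < 2 ^ n.
Proof.
rewrite /nat_of_bits; elim: n => [|n IH]; first by rewrite big_ord0.
rewrite big_ord_recr expnS mul2n -addnn -addSn leq_add //.
by case: (a _); rewrite ?mul1n.
Qed.

Lemma nat_of_bitsS a n :
  nat_of_bits a n.+1 = nat_of_bits a n (^) (if a n then 2 ^ n else 0).
Proof.
rewrite {1}/nat_of_bits big_ord_recr /= -/(nat_of_bits a n).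
by case: (a n); rewrite ?mul1n ?addn_exp2 ?nat_of_bits_ltn // addn0 Nat.lxor_0_r.
Qed.

Lemma testbit_nat_of_bits a n i : Nat.testbit (nat_of_bits a n) i = (i < n) && a i.
Proof.
elim: n => [|n IH]; first by rewrite /nat_of_bits big_ord0 Nat.bits_0.
rewrite nat_of_bitsS Nat.lxor_spec IH ltnS (leq_eqVlt i) eq_sym.
have -> : Nat.testbit (if a n then 2 ^ n else 0) i = a n && (n == i).
  by case: (a n); rewrite ?testbit_exp2 // Nat.bits_0.
case: eqP => [<-|_] /=; first by rewrite ltnn andbT.
by rewrite andbF Bool.xorb_false_r.
Qed.

Lemma eq_nat_of_bits a b n :
  (forall i, i < n -> a i = b i) -> nat_of_bits a n = nat_of_bits b n.
Proof. by move=> ab; apply: eq_bigr => i _; rewrite ab. Qed.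

Lemma nat_of_testbit g n : g < 2 ^ n -> nat_of_bits (Nat.testbit g) n = g.
Proof.
move=> gn; apply: Nat.bits_inj => i; rewrite testbit_nat_of_bits.
by case: ltnP => // /(testbit_above gn) ->.
Qed.

Lemma nat_of_bits_xor a b n :
  nat_of_bits (fun i => xorb (a i) (b i)) n = nat_of_bits a n (^) nat_of_bits b n.
Proof.
by apply: Nat.bits_inj => i; rewrite Nat.lxor_spec !testbit_nat_of_bits; case: ltnP.
Qed.

(** * The vertices of the graph of ordered pairs as labelled binary trees *)

Fixpoint OP_finite (n : nat) : Finite (OP n) :=
  match n with
  | 0 => Finite.on bool
  | m.+1 => let OPm := Finite.Pack (OP_finite m) in Finite.on (OPm * OPm)%type
  end.
HB.instance Definition _ (n : nat) : Finite (OP n) := OP_finite n.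

Lemma card_OP n : #|{: OP n}| = 2 ^ 2 ^ n.
Proof.
elim: n => [|n IH]; first exact: card_bool.
transitivity #|{: OP n * OP n}|; first by [].
by rewrite card_prod IH -expnD addnn -mul2n expnS.
Qed.

Lemma Phi_fst n (v : OP n.+1) h : h < 2 ^ n -> Phi v h = Phi v.1 h.
Proof. by move=> hn /=; rewrite hn. Qed.

Lemma Phi_snd n (v : OP n.+1) h : h < 2 ^ n -> Phi v (h (^) 2 ^ n) = Phi v.2 h.
Proof. by move=> hn /=; rewrite -addn_exp2 // ltnNge leq_addl /= addn_exp2 // lxorC lxorK. Qed.

Lemma Phi_inj n (u v : OP n) : (forall h, h < 2 ^ n -> Phi u h = Phi v h) -> u = v.
Proof.
elim: n u v => [|n IH] u v uv; first exact: (uv 0).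
rewrite (surjective_pairing u) (surjective_pairing v); congr (_, _); apply: IH => h hn.
  by rewrite -!Phi_fst //; exact/uv/ltn_exp2S.
by rewrite -!Phi_snd //; exact/uv/lxor_exp2_ltn.
Qed.

Definition shift (g : nat) (w : nat -> bool) : nat -> bool := fun k => w (k (^) g).

Lemma shift_shift g h w : shift g (shift h w) = shift (g (^) h) w.
Proof. by apply/funext => k; rewrite /shift lxorA. Qed.

Lemma shiftC g h w : shift g (shift h w) = shift h (shift g w).
Proof. by rewrite !shift_shift lxorC. Qed.

Lemma shift0 w : shift 0 w = w.
Proof. by apply/funext => k; rewrite /shift Nat.lxor_0_r. Qed.

Lemma shiftK g : involutive (shift g).
Proof. by move=> w; rewrite shift_shift Nat.lxor_nilpotent shift0. Qed.

Fixpoint config_tree (n : nat) (w : nat -> bool) : OP n :=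
  match n with
  | 0 => w 0
  | m.+1 => (config_tree m w, config_tree m (shift (2 ^ m) w))
  end.

Lemma Phi_config_tree n w h : h < 2 ^ n -> Phi (config_tree n w) h = w h.
Proof.
elim: n w h => [|n IH] w h; first by case: h.
by case/ltn_exp2SP => [hn|[g gn ->]]; [rewrite Phi_fst ?IH | rewrite Phi_snd ?IH].
Qed.

Lemma config_tree_eqP n w w' :
  config_tree n w = config_tree n w' <-> forall k, k < 2 ^ n -> w k = w' k.
Proof.
split=> [ww' k kn|ww']; first by rewrite -(Phi_config_tree w kn) ww' Phi_config_tree.
by apply: Phi_inj => k kn; rewrite !Phi_config_tree // ww'.
Qed.

Lemma config_treeK n : cancel (@Phi n) (config_tree n).
Proof. by move=> v; apply: Phi_inj => h hn; rewrite Phi_config_tree. Qed.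

(* The Hamming distance minimised over the automorphisms of the binary tree. *)
Fixpoint tdist (n : nat) : OP n -> OP n -> nat :=
  match n return OP n -> OP n -> nat with
  | 0 => fun u v => u != v
  | m.+1 => fun u v => minn (tdist u.1 v.1 + tdist u.2 v.2)
                            (tdist u.1 v.2 + tdist u.2 v.1)
  end.

Lemma tdist_shift n g u w : g < 2 ^ n ->
  tdist u (config_tree n (shift g w)) = tdist u (config_tree n w).
Proof.
elim: n g u w => [|n IH] g u w; first by case: g => // _; rewrite shift0.
move=> /ltn_exp2SP[gn|[h hn ->]] /=; first by rewrite shiftC !(IH g).
by rewrite shiftC -!(shift_shift h) !(IH h) // shiftK minnC.
Qed.

Definition dyadic_isometry (n : nat) (phi : nat -> nat) : Prop :=
  forall j g h, j <= n -> g < 2 ^ n -> h < 2 ^ n ->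
    (phi g (^) phi h < 2 ^ j) = (g (^) h < 2 ^ j).

Lemma dyadic_isometryS n phi : dyadic_isometry n.+1 phi ->
  [/\ dyadic_isometry n phi, dyadic_isometry n (fun g => phi (g (^) 2 ^ n)) &
      exists2 h, h < 2 ^ n & phi (2 ^ n) = h (^) 2 ^ n (^) phi 0].
Proof.
move=> iso; split=> [j g h jn gn hn|j g h jn gn hn|].
- by apply: iso; rewrite ?ltn_exp2S // leqW.
- rewrite iso ?leqW ?lxor_exp2_ltn //.
  by rewrite lxorA (lxorAC g) lxorK.
have ltnS0 : 2 ^ n (^) 0 < 2 ^ n.+1 by rewrite Nat.lxor_0_r ltn_exp2l.
have : phi (2 ^ n) (^) phi 0 < 2 ^ n.+1 by rewrite iso ?ltn_exp2l ?expn_gt0.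
case/ltn_exp2SP => [|[h hn e]]; last by exists h; rewrite // -e lxorK.
by rewrite iso ?leqnSn ?ltn_exp2l ?expn_gt0 // Nat.lxor_0_r ltnn.
Qed.

Lemma tdist_le_mismatch n phi w w' : dyadic_isometry n phi ->
  tdist (config_tree n w) (config_tree n (shift (phi 0) w')) <=
  \sum_(g < 2 ^ n) (w g != w' (phi g)).
Proof.
elim: n phi w => [|n IH] phi w.
  by rewrite big_ord_recl big_ord0 addn0 /= /shift Nat.lxor_0_l.
case/dyadic_isometryS => iso_low iso_high [h hn phin].
rewrite (big_exp2S _ _ (fun g => nat_of_bool (w g != w' (phi g)))) /= geq_min.
apply/orP; left; apply: leq_add; first exact: IH.
have := IH _ (shift (2 ^ n) w) iso_high.
by rewrite /= Nat.lxor_0_l phin -!(shift_shift _ (phi 0)) -shift_shift tdist_shift.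
Qed.

(** * Configurations constant on cosets *)

Section InvariantConfigurations.
Variable sigma : nat -> bool.

Fixpoint ones (n : nat) : nat := if n is k.+1 then sigma k + ones k else 0.

Lemma sum_ones n : \sum_(i < n) sigma i = ones n.
Proof. by elim: n => [|n IH]; rewrite ?big_ord0 // big_ord_recr /= IH addnC. Qed.

(* Parametrizes the configurations on [D_n] that are constant on the cosets of [D^sigma]. *)
Fixpoint tree_expand (n : nat) : OP (ones n) -> OP n :=
  match n return OP (ones n) -> OP n with
  | 0 => id
  | k.+1 => match sigma k as b return OP (b + ones k) -> OP k.+1 with
            | true => fun u => (tree_expand u.1, tree_expand u.2)
            | false => fun u => (tree_expand u, tree_expand u)
            end
  end.

Lemma tdist_tree_expand n u v :
  2 ^ ones n * tdist (@tree_expand n u) (tree_expand v) = 2 ^ n * tdist u v.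
Proof.
elim: n u v => // n IH /=; case: (sigma n) => u v /=.
  by rewrite !expnS -!mulnA; congr (2 * _); rewrite !minnMr !mulnDr !IH.
by rewrite minnn addnn -mul2n mulnCA IH expnS mulnA.
Qed.

Definition invariant_config (w : nat -> bool) : Prop :=
  forall i, sigma i = false -> shift (2 ^ i) w = w.

Lemma invariant_config_shift g w : invariant_config w -> invariant_config (shift g w).
Proof. by move=> inv i si; rewrite shiftC inv. Qed.

Lemma config_tree_invariant n w : invariant_config w ->
  exists u, config_tree n w = tree_expand u.
Proof.
elim: n w => [|n IH] w inv /=; first by exists (w 0).
have [u eu] := IH _ inv; have [v ev] := IH _ (invariant_config_shift (2 ^ n) inv).
case: (sigma n) (inv n) => [_|/(_ erefl) ->]; first by exists (u, v); rewrite eu ev.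
by exists u; rewrite eu.
Qed.

Lemma same_coset_exp2 i k : sigma i = false -> same_coset sigma k (k (^) 2 ^ i).
Proof.
by move=> si j; rewrite lxorA Nat.lxor_nilpotent Nat.lxor_0_l testbit_exp2 => /eqP<-.
Qed.

Lemma coset_keyE n k : k < 2 ^ n ->
  coset_key sigma k = [seq i <- iota 0 n | Nat.testbit k i && sigma i].
Proof.
move=> kn; apply: (irr_sorted_eq ltn_trans ltnn).
- exact/(sorted_filter ltn_trans)/iota_ltn_sorted.
- exact/(sorted_filter ltn_trans)/iota_ltn_sorted.
move=> i; rewrite !mem_filter !mem_iota /= !add0n ltnS.
case ki : (Nat.testbit k i) => //=; rewrite (testbit_leq ki).
by case: ltnP => // /(testbit_above kn); rewrite ki.
Qed.

Lemma coset_key_lxor_exp2 n k : k < 2 ^ n -> coset_key sigma (k (^) 2 ^ n) =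
  if sigma n then rcons (coset_key sigma k) n else coset_key sigma k.
Proof.
move=> kn; rewrite (coset_keyE (lxor_exp2_ltn kn)) (coset_keyE kn).
rewrite -[n.+1]addn1 iotaD filter_cat /= add0n.
rewrite Nat.lxor_spec (testbit_above kn (leqnn n)) testbit_exp2 eqxx /=.
rewrite (eq_in_filter (a2 := fun i => Nat.testbit k i && sigma i)) => [|i].
  by case: (sigma n); rewrite ?cats1 ?cats0.
rewrite mem_iota /= add0n Nat.lxor_spec testbit_exp2 => ltin.
by rewrite gtn_eqF // Bool.xorb_false_r.
Qed.

Lemma map_coset_key_exp2S n : let keys := map (coset_key sigma) (iota 0 (2 ^ n)) in
  map (coset_key sigma) (iota 0 (2 ^ n.+1)) =
  keys ++ (if sigma n then map (fun s => rcons s n) keys else keys).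
Proof.
have keyS k : k \in iota 0 (2 ^ n) -> coset_key sigma (2 ^ n + k) =
    if sigma n then rcons (coset_key sigma k) n else coset_key sigma k.
  by rewrite mem_iota /= add0n => kn; rewrite addnC addn_exp2 // coset_key_lxor_exp2.
rewrite /= expnS mul2n -addnn iotaD map_cat add0n; congr (_ ++ _).
rewrite -[X in iota X _]addn0 iotaDl.
by case: (sigma n) keyS => keyS; rewrite -!map_comp; exact/eq_in_map.
Qed.

Lemma size_undup_coset_key n :
  size (undup (map (coset_key sigma) (iota 0 (2 ^ n)))) = 2 ^ ones n.
Proof.
elim: n => //= n IH; rewrite map_coset_key_exp2S; set keys := map _ _ in IH *.
rewrite undup_cat size_cat; case: (sigma n); last first.
  by rewrite (eq_in_filter (a2 := pred0)) ?filter_pred0 // => s; rewrite mem_undup => ->.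
rewrite (eq_in_filter (a2 := predT)) ?filter_predT => [|s].
  have rcons_inj_n : injective (fun s => rcons s n) by move=> s t /rcons_inj[].
  by rewrite (undup_map_inj rcons_inj_n) size_map IH addnn -mul2n -expnS.
rewrite mem_undup => /mapP[k]; rewrite mem_iota /= add0n => kn ->; apply/negP => /mapP[t _].
move=> /(congr1 (fun s => n \in s)); rewrite mem_rcons mem_head (coset_keyE kn).
by rewrite mem_filter mem_iota /= add0n ltnn andbF.
Qed.

End InvariantConfigurations.

(** * Counting trees in balls *)

Local Open Scope ring_scope.

Lemma sum_OPS (V : nmodType) n (F : OP n.+1 -> V) :
  \sum_v F v = \sum_(v1 : OP n) \sum_(v2 : OP n) F (v1, v2).
Proof. by rewrite pair_bigA; apply: eq_bigr => -[]. Qed.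

Lemma card_le_sum (R : numDomainType) (T : finType) (B : {set T}) (F : T -> R) (c : R) :
  (forall x, 0 <= F x) -> {in B, forall x, c <= F x} -> c * #|B|%:R <= \sum_x F x.
Proof.
move=> F0 cF; rewrite mulr_natr -sumr_const [leRHS](bigID (mem B)) /= -[leLHS]addr0.
by apply: lerD; [exact: ler_sum | exact: sumr_ge0].
Qed.

Definition tdist_genfun (R : pzSemiRingType) (t : R) n (u : OP n) : R :=
  \sum_v t ^+ tdist u v.

Definition tball n (u : OP n) : {set OP n} := [set v | (64 * tdist u v < 2 ^ n)%N].

Section BallCount.
Variable R : realFieldType.
Implicit Type t : R.

Lemma tdist_genfun_ge0 t n (u : OP n) : 0 <= t -> 0 <= tdist_genfun t u.
Proof. by move=> t0; apply: sumr_ge0 => v _; rewrite exprn_ge0. Qed.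

Lemma tdist_genfun0 t (u : OP 0) : tdist_genfun t u = 1 + t.
Proof. by rewrite /tdist_genfun [LHS](big_bool _ _); case: u; rewrite //= addrC. Qed.

Lemma tdist_genfunS t n (u : OP n.+1) : 0 <= t ->
  tdist_genfun t u <= 2 * tdist_genfun t u.1 * tdist_genfun t u.2.
Proof.
move=> t0; rewrite -mulrA mulr_natl mulr2n /tdist_genfun sum_OPS.
rewrite {1}big_distrlr [X in _ + X]big_distrlr /= [X in _ + X]exchange_big -big_split.
apply: ler_sum => v1 _; rewrite -big_split; apply: ler_sum => v2 _ /=.
by rewrite -!exprD; case: leqP => _; rewrite ?lerDl ?lerDr exprn_ge0.
Qed.

(* At most 4 of the 16 trees of depth 2 are at distance 0 from a given one. *)
Lemma tdist_genfun2 t (u : OP 2) : 0 <= t <= 1 -> tdist_genfun t u <= 4 + 12 * t.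
Proof.
move=> /andP[t0 t1].
have expr_tdist d : t ^+ d <= if d == 0%N then 1 else t.
  by case: d => [|d] //=; rewrite exprS ler_piMr // exprn_ile1.
apply: (@le_trans _ _ (\sum_(v : OP 2) if tdist u v == 0%N then 1 else t)).
  by apply: ler_sum => v _; exact: expr_tdist.
rewrite sum_OPS; under eq_bigr do rewrite sum_OPS; rewrite sum_OPS.
case: u => [[[] []] [[] []]]; rewrite !(big_bool _ _) /= /minn /=; lra.
Qed.

Lemma tdist_genfun_le t p (u : OP p.+2) : 0 <= t <= 1 ->
  2 * tdist_genfun t u <= (8 + 24 * t) ^+ (2 ^ p).
Proof.
move=> t01; have [t0 _] := andP t01.
elim: p u => [|p IH] u; first by have := tdist_genfun2 u t01; rewrite expr1; lra.
have ge0 v : 0 <= 2 * tdist_genfun t (v : OP p.+2) by rewrite mulr_ge0 ?tdist_genfun_ge0.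
rewrite expnS mul2n -addnn exprD.
apply: le_trans (ler_pM (ge0 u.1) (ge0 u.2) (IH u.1) (IH u.2)).
by have := tdist_genfunS u t0; lra.
Qed.

(* Chernoff bound: every tree of the ball contributes at least [(3 / 4) ^ 2 ^ p] to the
   generating function at [t = (3 / 4) ^ 16]. *)
Lemma card_tball_le p (u : OP p.+2) : 2 * #|tball u|%:R <= 11 ^+ (2 ^ p) :> R.
Proof.
pose t : R := (3 / 4) ^+ 16.
have t96 : 0 <= t <= 1 / 96 by rewrite /t; apply/andP; split; lra.
have t0 : 0 <= t by case/andP: t96.
have t01 : 0 <= t <= 1 by lra.
have ball_le : (3 / 4) ^+ (2 ^ p) * #|tball u|%:R <= tdist_genfun t u.
  apply: card_le_sum => [v|v]; first by rewrite exprn_ge0.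
  rewrite inE !expnS -exprM => ball_v.
  by apply: ler_wiXn2l; [lra | lra | lia].
have genfun_le : 2 * tdist_genfun t u <= (3 / 4) ^+ (2 ^ p) * 11 ^+ (2 ^ p).
  apply: le_trans (tdist_genfun_le u t01) _; rewrite -exprMn.
  by apply: lerXn2r; rewrite ?nnegrE; lra.
have pos : 0 < (3 / 4 : R) ^+ (2 ^ p) by rewrite exprn_gt0 //; lra.
rewrite -(ler_pM2l pos); lra.
Qed.

Lemma card_tball n (u : OP n) :
  2 * #|tball u|%:R <= 2 ^+ (2 ^ n) * (11 / 16) ^+ (2 ^ n %/ 4) :> R.
Proof.
have small m (v : OP m) : (2 ^ m <= 64)%N -> #|tball v|%:R <= tdist_genfun 0 v :> R.
  move=> m64; rewrite -[leLHS]mul1r; apply: card_le_sum => [w|w].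
    by rewrite exprn_ge0.
  by rewrite inE; case: (tdist v w) => // d; lia.
case: n u => [|[|p]] u.
- by have := small 0 u isT; rewrite tdist_genfun0 !expr0; lra.
- have := small 1 u isT; have := @tdist_genfunS 0 0 u (lexx _).
  by rewrite !tdist_genfun0 !expr0; lra.
rewrite !expnS mulnA mulKn // [2 ^+ _]exprM -exprMn.
have -> : 2 ^+ (2 * 2) * (11 / 16) = 11 :> R by lra.
exact: card_tball_le.
Qed.

End BallCount.

(** * The ultrametric of a refining sequence of codes *)

Local Open Scope classical_set_scope.

Lemma ler_invr_exp2 (R : realFieldType) (M N : nat) :
  (M <= N)%N -> (2 ^+ N)^-1 <= (2 ^+ M)^-1 :> R.
Proof. by move=> MN; rewrite lef_pV2 ?posrE ?exprn_gt0 // ler_weXn2l // ler1n. Qed.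

Section CodeMetric.
Context (d : measure_display) (T : measurableType d) (R : realType).
Variables (U : countType) (code : nat -> T -> U).
Hypothesis code_refines : forall N x y, code N.+1 x = code N.+1 y -> code N x = code N y.
Hypothesis code_separates : forall x y, (forall N, code N x = code N y) -> x = y.
Hypothesis measurable_code_fiber : forall N s, measurable [set x | code N x = s].

(* The supremum of the empty set is [0]. *)
Definition code_dist (x y : T) : R :=
  sup [set (2 ^+ N)^-1 | N in [set N | code N x <> code N y]].

Lemma code_dist_ge N x y : code N x <> code N y -> (2 ^+ N)^-1 <= code_dist x y.
Proof.
move=> xy; apply: ub_le_sup; last by exists N.
by exists 1 => _ [M _ <-]; have := ler_invr_exp2 R (leq0n M); rewrite expr0 invr1.
Qed.

Lemma code_dist_lub x y r : 0 <= r ->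
  (forall N, code N x <> code N y -> (2 ^+ N)^-1 <= r) -> code_dist x y <= r.
Proof.
move=> r0 ub; rewrite /code_dist; set E := [set _ | _ in _].
have [->|/set0P E0] := eqVneq E set0; first by rewrite sup0.
by apply: ge_sup => // _ [N xy <-]; exact: ub.
Qed.

Lemma code_dist_ge0 x y : 0 <= code_dist x y.
Proof.
have [[N xy]|none] := pselect (exists N, code N x <> code N y).
  by apply: le_trans (code_dist_ge xy); rewrite invr_ge0 exprn_ge0.
rewrite /code_dist (_ : [set N | _] = set0) ?image_set0 ?sup0 // -subset0 => N xy.
by apply: none; exists N.
Qed.

Lemma code_dist_le1 x y : code_dist x y <= 1.
Proof.
apply: code_dist_lub => // N _.
by have := ler_invr_exp2 R (leq0n N); rewrite expr0 invr1.
Qed.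

Lemma eq_code_le M N x y : (M <= N)%N -> code N x = code N y -> code M x = code M y.
Proof.
by move=> /subnK <-; elim: (N - M)%N => // k IH; rewrite addSn => /code_refines; exact: IH.
Qed.

Lemma code_dist_le N x y : code N x = code N y -> code_dist x y <= (2 ^+ N)^-1.
Proof.
move=> xyN; apply: code_dist_lub => [|M xyM]; first by rewrite invr_ge0 exprn_ge0.
apply: ler_invr_exp2; rewrite leqNgt; apply/negP => /ltnW MN.
exact/xyM/eq_code_le/xyN.
Qed.

Lemma code_dist_eq0 x y : code_dist x y = 0 <-> x = y.
Proof.
split=> [dist0|->]; last by apply/eqP; rewrite eq_le code_dist_ge0 code_dist_lub.
apply: code_separates => N; apply: contrapT => /code_dist_ge.
by rewrite dist0 leNgt invr_gt0 exprn_gt0.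
Qed.

Lemma code_distC x y : code_dist x y = code_dist y x.
Proof. by rewrite /code_dist; congr (sup (image _ _)); apply/seteqP; split=> N /= xy /esym. Qed.

Lemma code_dist_triangle x y z : code_dist x z <= code_dist x y + code_dist y z.
Proof.
apply: code_dist_lub => [|N xz]; first by rewrite addr_ge0 ?code_dist_ge0.
have [xy|/eqP xy] := eqVneq (code N x) (code N y).
  by rewrite -[leLHS]add0r lerD ?code_dist_ge0 // code_dist_ge // -xy.
by rewrite -[leLHS]addr0 lerD ?code_dist_ge0 // code_dist_ge.
Qed.

Lemma measurable_code_invariant N (B : set T) :
  (forall x y, code N x = code N y -> B x -> B y) -> measurable B.
Proof.
move=> inv; rewrite (_ : B = \bigcup_(s in code N @` B) [set x | code N x = s]).
  rewrite bigcup_mkcond; apply: countable_bigcupT_measurable => // s.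
  by case: ifP.
apply/seteqP; split=> [x Bx|x [_ [y By <-] /= /esym xy]]; last exact: inv By.
by exists (code N x) => //; exists x.
Qed.

Lemma measurable_code_neq N : measurable [set z : T * T | code N z.1 <> code N z.2].
Proof.
rewrite (_ : mkset _ = ~` \bigcup_s ([set x | code N x = s] `*` [set x | code N x = s])).
  apply: measurableC; apply: countable_bigcupT_measurable => // s.
  exact: measurableX.
apply/seteqP; split=> [[x y] /= xy [s _ [/= xs ys]]|[x y] /= nxy xy].
  by apply: xy; rewrite xs ys.
by apply: nxy; exists (code N x).
Qed.

Lemma measurable_code_dist : measurable_fun setT (fun z : T * T => code_dist z.1 z.2).
Proof.
apply: (measurability _ (RGenOInfty.measurableE R)).
move=> _ [_ [r ->] <-]; rewrite setTI.
have [r0|r0] := ltP r 0.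
  rewrite (_ : _ @^-1` _ = setT) //; apply/seteqP; split=> // -[x y] _ /=.
  by rewrite in_itv /= andbT (lt_le_trans r0) // code_dist_ge0.
rewrite (_ : _ @^-1` _ =
  \bigcup_(N in [set N | r < (2 ^+ N)^-1]) [set z : T * T | code N z.1 <> code N z.2]).
  by apply: bigcup_measurable => N _; exact: measurable_code_neq.
apply/seteqP; split=> [[x y]|[x y] [N /= rN xy]] /=; rewrite in_itv /= andbT.
  apply: contraPP => none; apply/negP; rewrite -leNgt; apply: code_dist_lub => // N xy.
  by rewrite leNgt; apply/negP => rN; apply: none; exists N.
exact: lt_le_trans rN (code_dist_ge xy).
Qed.

Lemma code_dist_separable :
  exists2 D : set T, countable D & forall x e, 0 < e -> exists2 t, D t & code_dist x t < e.
Proof.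
pose rep (Ns : nat * U) : T := xget point [set x | code Ns.1 x = Ns.2].
exists (range rep); first exact: (sub_countable (card_image_le _ _) (countableP _)).
move=> x e e0; have [N _ /(_ N (leqnn N))] := near_infty_natSinv_expn_lt (PosNum e0).
rewrite /= div1r => ltNe; exists (rep (N, code N x)); first by exists (N, code N x).
apply: le_lt_trans ltNe; apply: code_dist_le; apply/esym.
exact: (@xgetI _ point [set z | code N z = code N x] x).
Qed.

Lemma code_dist_admissible (mu : probability T R) : admissible mu code_dist.
Proof.
split; first exact: measurable_code_dist.
split.
  apply: measurable_bounded_integrable => //; last 2 first.
  - exact: measurable_code_dist.
  - exists 1; split=> [|M M1 z _]; first exact: num_real.
    by rewrite /= ger0_norm ?code_dist_ge0 // (le_trans (code_dist_le1 _ _)) // ltW.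
  rewrite -setXTT /= product_measure1E // -[ltLHS]/(mu setT * mu setT)%E.
  by rewrite probability_setT mule1 ltry.
exists setT; split=> //; split; first by rewrite setCT measure0.
split=> [x y _ _|]; first exact: code_dist_eq0.
split=> [x y _ _|]; first exact: code_distC.
split=> [x y z _ _ _|]; first exact: code_dist_triangle.
have [D cD sepD] := code_dist_separable.
by exists D; split=> //; split=> // x _ e; exact: sepD.
Qed.

End CodeMetric.

(** * Partitions into sets of small diameter *)

Section EntropyBounds.
Context (d : measure_display) (T : measurableType d) (R : realType).
Variables (mu : probability T R) (S : nat -> T -> T -> Prop) (rho : T -> T -> R).

Lemma eps_partition_label (F : finType) (label : T -> option F) n (r eps : R) :
  r < eps ->
  (forall l, measurable (label @^-1` [set l])) ->
  (forall x y, S n x y -> label x = label y) ->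
  (mu (label @^-1` [set None]) < eps%:E)%E ->
  (forall x y u, label x = Some u -> label y = Some u -> (Kant S rho n x y <= r%:E)%E) ->
  eps_partition mu S rho eps n #|F|.
Proof.
move=> reps mlabel Slabel small_rest diam_label.
pose index (l : option F) := if l is Some u then (enum_rank u).+1 else 0%N.
have index_inj : injective index.
  by move=> [u|] [v|] //= [/ord_inj/enum_rank_inj ->].
have pieceE j : [set x | index (label x) = j] =
    \bigcup_(l in [set l | index l = j]) label @^-1` [set l].
  by apply/seteqP; split=> [x xj|x [l lj /= ->] //]; exists (label x).
exists (fun j => [set x | index (label x) = j]); split=> [j _|].
  split=> [|x y /Slabel xy]; last by rewrite /= xy.
  by rewrite pieceE; apply: fin_bigcup_measurable => // l _.
split=> [i j _ _ ij|]; first by rewrite -subset0 => x [/= xi xj]; apply: ij; rewrite -xi.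
split.
  apply/seteqP; split=> // x _; exists (index (label x)) => //=.
  by case: (label x) => //= u; exact: ltn_ord.
split.
  rewrite (_ : mkset _ = label @^-1` [set None]) //.
  by apply/seteqP; split=> x /=; [case: (label x) | move=> ->].
case=> // j _; apply: (@le_lt_trans _ _ r%:E); last by rewrite lte_fin.
apply: ge_ereal_sup => _ [x [y [/= jx [jy ->]]]].
have xy : label x = label y by apply: index_inj; rewrite jx jy.
case ux : (label x) jx => [u|] // _; apply: (diam_label _ _ u) => //.
by rewrite -xy.
Qed.

Lemma eps_partition_mass n k (eps c : R) : eps_partition mu S rho eps n k ->
  (forall Y, measurable Y -> (Kdiam S rho n Y < eps%:E)%E -> (mu Y <= c%:E)%E) ->
  1 <= eps + k%:R * c.
Proof.
move=> [Y [mY [_ [covY [muY0 diamY]]]]] small_mass; rewrite -lee_fin.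
have sub_cov : setT `<=` \big[setU/set0]_(j < k.+1) Y j.
  by rewrite -covY -bigcup_mkord => x [j jk Yj]; exists j.
rewrite -(probability_setT mu).
apply: (@le_trans _ _ (\sum_(j < k.+1) mu (Y j))%E).
  by apply: content_subadditive => // j jk; case: (mY j jk).
rewrite big_ord_recl EFinD; apply: leeD; first exact: ltW.
apply: (@le_trans _ _ (\sum_(j < k) c%:E)%E).
  apply: lee_sum => j _; apply: small_mass; last by apply: diamY; exact: (ltn_ord j).
  by case: (mY _ (ltn_ord j)).
by rewrite sumEFin lee_fin sumr_const card_ord mulr_natl.
Qed.

Lemma ln2_gt0 : 0 < ln 2 :> R.
Proof. by rewrite ln_gt0 // ltr1n. Qed.

Lemma entropy_ge n (eps c : R) : 0 < c ->
  (forall k, eps_partition mu S rho eps n k -> c <= k%:R) ->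
  ((ln c / ln 2)%:E <= entropy mu S rho eps n)%E.
Proof.
move=> c0 lb; rewrite /entropy; set E := [set _ | _ in _].
have : (c%:E <= ereal_inf E)%E by apply: le_ereal_inf_tmp => _ [k /lb ck <-].
case: (ereal_inf E) => [r| |] //; rewrite ?leey // !lee_fin => cr.
by rewrite ler_pM2r ?invr_gt0 ?ln2_gt0 // ler_ln ?posrE // (lt_le_trans c0).
Qed.

Lemma entropy_le n (eps : R) k : eps_partition mu S rho eps n k ->
  (entropy mu S rho eps n <= (ln k%:R / ln 2)%:E)%E.
Proof.
move=> part; rewrite /entropy; set E := [set _ | _ in _].
have : (ereal_inf E <= k%:R%:E)%E by apply: ereal_inf_lbound; exists k.
have : (0 <= ereal_inf E)%E by apply: le_ereal_inf_tmp => _ [j _ <-]; rewrite lee_fin.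
case: (ereal_inf E) => [r| |] //; rewrite !lee_fin => r0 rk.
rewrite ler_pM2r ?invr_gt0 ?ln2_gt0 //.
have [rpos|rneg] := ltP 0 r; first by rewrite ler_ln ?posrE // (lt_le_trans rpos).
rewrite (ln0 rneg); case: (k) => [|j]; first by rewrite ln0.
by rewrite ln_ge0 // ler1n.
Qed.

End EntropyBounds.

Lemma limn_esup_near_le (R : realType) (u : nat -> \bar R) (c : \bar R) :
  (\forall n \near \oo, (u n <= c)%E) -> (limn_esup u <= c)%E.
Proof.
move=> uc; apply: ge_ereal_inf; exists (ereal_sup (u @` [set n | (u n <= c)%E])).
  by exists [set n | (u n <= c)%E].
by apply: ge_ereal_sup => _ [n /= unc <-].
Qed.

Lemma asymp_bounds (R : realType) (a : nat -> \bar R) (b : nat -> R) (c C : R) : 0 < c ->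
  (forall n, 0 < b n) ->
  (\forall n \near \oo, ((c * b n)%:E <= a n)%E) ->
  (\forall n \near \oo, (a n <= (C * b n)%:E)%E) ->
  asymp a b.
Proof.
move=> c0 b0 ca aC; split.
  apply: (@lt_le_trans _ _ c%:E); first by rewrite lte_fin.
  rewrite /limn_einf leeNr; apply: limn_esup_near_le.
  by near do rewrite leeN2 lee_pdivlMr // -EFinM.
apply: (@le_lt_trans _ _ C%:E); last exact: ltry.
by apply: limn_esup_near_le; near do rewrite lee_pdivrMr // -EFinM.
Unshelve. all: by end_near. Qed.

(** * Isomorphic filtrations *)

Lemma measurable_fun_preimage {d1 d2 : measure_display} {T1 : measurableType d1}
    {T2 : measurableType d2} (f : T1 -> T2) (B : set T2) :
  measurable_fun setT f -> measurable B -> measurable (f @^-1` B).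
Proof. by move=> mf mB; rewrite -[_ @^-1` _]setTI; exact: mf. Qed.

Lemma measurable_fun_diagonal {d1 d2 : measure_display} {T1 : measurableType d1}
    {T2 : measurableType d2} (f : T1 -> T2) :
  measurable_fun setT f -> measurable_fun setT (fun z : T1 * T1 => (f z.1, f z.2)).
Proof. by move=> mf; apply: measurable_fun_pair; exact: measurableT_comp. Qed.

Lemma image_class {T1 T2 : Type} (E1 : T1 -> T1 -> Prop) (E2 : T2 -> T2 -> Prop)
    (f : T1 -> T2) (g : T2 -> T1) x :
  cancel g f -> (forall z t, E1 z t <-> E2 (f z) (f t)) -> f @` E1 x = E2 (f x).
Proof.
move=> gK fE; apply/seteqP; split=> [_ [z xz <-]|y xy]; first exact/fE.
by exists (g y); rewrite ?gK //; apply/fE; rewrite gK.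
Qed.

Lemma bij_class {T1 T2 : Type} (E1 : T1 -> T1 -> Prop) (E2 : T2 -> T2 -> Prop)
    (f : T1 -> T2) (g : T2 -> T1) x :
  cancel f g -> cancel g f -> (forall z t, E1 z t <-> E2 (f z) (f t)) ->
  set_bij (E1 x) (E2 (f x)) f.
Proof.
move=> fK gK fE; rewrite -(image_class x gK fE).
by apply: inj_bij => z t _ _; exact: (can_inj fK).
Qed.

Record filtration_iso {d1 d2 : measure_display} {T1 : measurableType d1}
    {T2 : measurableType d2} {R : realType} (mu1 : probability T1 R) (mu2 : probability T2 R)
    (S1 : nat -> T1 -> T1 -> Prop) (S2 : nat -> T2 -> T2 -> Prop)
    (f : T1 -> T2) (g : T2 -> T1) : Prop := FiltrationIso {
  iso_fK : cancel f g;
  iso_gK : cancel g f;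
  iso_measurable : measurable_fun setT f;
  iso_measurable_inv : measurable_fun setT g;
  iso_class : forall n x y, S1 n x y <-> S2 n (f x) (f y);
  iso_mass : forall B, measurable B -> mu2 B = mu1 (f @^-1` B) }.

Section FiltrationIsomorphism.
Context {d1 d2 : measure_display} {T1 : measurableType d1} {T2 : measurableType d2}.
Context {R : realType} {mu1 : probability T1 R} {mu2 : probability T2 R}.
Context {S1 : nat -> T1 -> T1 -> Prop} {S2 : nat -> T2 -> T2 -> Prop}.
Context {f : T1 -> T2} {g : T2 -> T1}.
Hypothesis iso : filtration_iso mu1 mu2 S1 S2 f g.

Lemma filtration_iso_sym : filtration_iso mu2 mu1 S2 S1 g f.
Proof.
have [fK gK mf mg fS fmu] := iso; split=> // [n x y|B mB]; first by rewrite fS !gK.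
rewrite fmu; last exact: measurable_fun_preimage.
by congr (mu1 _); apply/seteqP; split=> x /=; rewrite fK.
Qed.

Lemma iso_Kant_le (rho : T1 -> T1 -> R) n x y :
  (Kant S2 (fun z t => rho (g z) (g t)) n (f x) (f y) <= Kant S1 rho n x y)%E.
Proof.
have [fK gK _ _ fS _] := iso; have gS := iso_class filtration_iso_sym.
apply: le_ereal_inf_tmp => _ [s [bij_s sS] <-]; apply: ge_ereal_inf.
exists ((2 ^+ n)^-1 * \sum_(z \in S1 n x) rho z (s z))%:E => //.
exists (f \o s \o g); last first.
  congr (_ * _)%:E; rewrite (reindex_fsbig _ _ _ _ (bij_class x fK gK (fS n))).
  by apply: eq_fsbigr => z _; rewrite /= !fK.
split=> [|j jn z xz].
  apply: set_bij_comp (bij_class y fK gK (fS n)); apply: set_bij_comp bij_s.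
  by have := bij_class (f x) gK fK (gS n); rewrite fK.
have xgz : S1 n x (g z) by apply/fS; rewrite gK.
rewrite (_ : _ @` _ = f @` (s @` (g @` S2 j z))); last by rewrite !image_comp.
by rewrite (image_class z fK (gS j)) sS // (image_class _ gK (fS j)).
Qed.

Lemma iso_eps_partition (rho : T1 -> T1 -> R) eps n k :
  eps_partition mu1 S1 rho eps n k ->
  eps_partition mu2 S2 (fun z t => rho (g z) (g t)) eps n k.
Proof.
move=> [Y [mY [disjY [covY [massY0 diamY]]]]]; have [fK gK _ mg fS fmu] := iso.
exists (fun j => g @^-1` Y j); split=> [j /mY[mYj YjS]|].
  split=> [|z t zt]; first exact: measurable_fun_preimage.
  by apply: YjS; apply/fS; rewrite !gK.
split=> [i j ik jk ij|]; first by rewrite -preimage_setI disjY // preimage_set0.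
split; first by rewrite -preimage_bigcup covY preimage_setT.
split.
  rewrite fmu; last by apply: measurable_fun_preimage => //; case: (mY 0%N isT).
  rewrite (_ : _ @^-1` _ = Y 0%N) //.
  by apply/seteqP; split=> x /=; rewrite fK.
move=> j jk; apply: le_lt_trans (diamY j jk).
apply: ge_ereal_sup => _ [z [t [Yz [Yt ->]]]].
rewrite -[z]gK -[t]gK; apply: le_trans (iso_Kant_le _ _ _ _) _.
by apply: ereal_sup_ubound; exists (g z), (g t).
Qed.

Lemma iso_product_mass (B : set (T2 * T2)) : measurable B ->
  (mu2 \x mu2)%E B = pushforward (mu1 \x mu1)%E (fun z => (f z.1, f z.2)) B.
Proof.
move=> mB; have [_ _ mf _ _ fmu] := iso.
pose ff : {mfun (T1 * T1)%type >-> (T2 * T2)%type} :=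
  mfun_Sub (mem_set (measurable_fun_diagonal mf)).
apply: (@product_measure_unique _ _ _ _ _ mu2 mu2 (pushforward (mu1 \x mu1)%E ff)) => //.
move=> A1 A2 mA1 mA2; transitivity (mu1 (f @^-1` A1) * mu1 (f @^-1` A2))%E.
  by apply: product_measure1E; exact: measurable_fun_preimage.
by congr (_ * _)%E; exact/esym/fmu.
Qed.

Lemma iso_integrable (F : T1 * T1 -> \bar R) :
  (mu1 \x mu1)%E.-integrable setT F ->
  (mu2 \x mu2)%E.-integrable setT (fun z => F (g z.1, g z.2)).
Proof.
move=> int_F; have [fK _ mf mg _ _] := iso.
have mFg : measurable_fun setT (fun z => F (g z.1, g z.2)).
  exact: (measurableT_comp (measurable_int _ int_F) (measurable_fun_diagonal mg)).
pose ff : {mfun (T1 * T1)%type >-> (T2 * T2)%type} :=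
  mfun_Sub (mem_set (measurable_fun_diagonal mf)).
have /integrableP[_ int_Fg] :
    (pushforward (mu1 \x mu1)%E ff).-integrable setT (fun z => F (g z.1, g z.2)).
  apply: integrable_pushforward => //; rewrite preimage_setT.
  by apply: eq_integrable int_F => // -[x y] _ /=; rewrite !fK.
apply/integrableP; split=> //.
rewrite (eq_measure_integral (pushforward (mu1 \x mu1)%E ff)) // => B mB _.
exact: iso_product_mass.
Qed.

Lemma iso_admissible (rho : T1 -> T1 -> R) :
  admissible mu1 rho -> admissible mu2 (fun z t => rho (g z) (g t)).
Proof.
move=> [mrho [int_rho [A [mA [muA [dist0 [distC [tri [D [DA [cD sepD]]]]]]]]]]].
have [fK gK _ mg _ fmu] := iso.
have mgA : measurable (g @^-1` A) by exact: measurable_fun_preimage.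
split; first exact: (measurableT_comp mrho (measurable_fun_diagonal mg)).
split; first exact: (iso_integrable int_rho).
exists (g @^-1` A); split=> //; split.
  rewrite fmu; last exact: measurableC.
  by rewrite -muA; congr (mu1 _); apply/seteqP; split=> x /=; rewrite fK.
split=> [z t Az At|].
  by rewrite (dist0 _ _ Az At); split=> [/(can_inj gK)|->].
split=> [z t|]; first exact: distC.
split=> [z t u|]; first exact: tri.
exists (f @` D); split; first by move=> _ [x Dx <-]; rewrite /= fK; exact: DA.
split; first exact: (sub_countable (card_image_le _ _)).
move=> z Az e e0; have [x Dx ltx] := sepD _ Az e e0.
by exists (f x); [exists x | rewrite fK].
Qed.

End FiltrationIsomorphism.

Section IsomorphismInvariance.
Context {d1 d2 : measure_display} {T1 : measurableType d1} {T2 : measurableType d2}.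
Context {R : realType} {mu1 : probability T1 R} {mu2 : probability T2 R}.
Context {S1 : nat -> T1 -> T1 -> Prop} {S2 : nat -> T2 -> T2 -> Prop}.
Context {f : T1 -> T2} {g : T2 -> T1}.
Hypothesis iso : filtration_iso mu1 mu2 S1 S2 f g.

Lemma iso_entropy (rho : T1 -> T1 -> R) eps n :
  entropy mu2 S2 (fun z t => rho (g z) (g t)) eps n = entropy mu1 S1 rho eps n.
Proof.
rewrite /entropy; set E2 := mkset _; set E1 := mkset _.
suff -> : E2 = E1 by [].
apply/seteqP; split=> k; last exact: (iso_eps_partition iso).
move=> /(iso_eps_partition (filtration_iso_sym iso)).
by under [X in eps_partition _ _ X]eq_fun do under eq_fun do rewrite !(iso_fK iso).
Qed.

Lemma iso_scaling_sequence (h : nat -> R) :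
  scaling_sequence mu1 S1 h -> scaling_sequence mu2 S2 h.
Proof.
move=> [rho [adm_rho [eps0 [eps0_gt0 asymp_rho]]]].
exists (fun z t => rho (g z) (g t)); split; first exact: (iso_admissible iso).
exists eps0; split=> // eps eps_small.
by under eq_fun do rewrite iso_entropy; exact: asymp_rho.
Qed.

End IsomorphismInvariance.

(** * The orbit filtration *)

Lemma diag_diag g h (x : Xm) : diag g (diag h x) = diag (g (^) h) x.
Proof.
rewrite lxorC; congr (_, _); apply/funext => i /=; first by rewrite -lxorA (lxorC g).
by rewrite Nat.lxor_spec Bool.xorb_assoc.
Qed.

Lemma diag0 (x : Xm) : diag 0 x = x.
Proof.
case: x => w a; congr (_, _); apply/funext => i /=; first by rewrite Nat.lxor_0_r.
by rewrite Nat.bits_0 Bool.xorb_false_r.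
Qed.

Lemma diagK g : involutive (diag g).
Proof. by move=> x; rewrite diag_diag Nat.lxor_nilpotent diag0. Qed.

Lemma diag_free (x : Xm) : injective (diag^~ x).
Proof.
move=> g h /(congr1 snd) /funeqP gh; apply: Nat.bits_inj => i.
by have := gh i => /=; case: (x.2 i) (Nat.testbit _ _) (Nat.testbit _ _) => [] [] [].
Qed.

Lemma nat_of_bits_diag n g (x : Xm) : (g < 2 ^ n)%N ->
  nat_of_bits (diag g x).2 n = (nat_of_bits x.2 n (^) g)%N.
Proof. by move=> gn; rewrite /= nat_of_bits_xor nat_of_testbit. Qed.

Lemma zeta_diag n g (x : Xm) : (g < 2 ^ n)%N -> zeta n x (diag g x).
Proof. by move=> gn; exists g. Qed.

Lemma zeta_diag2 n g h (x : Xm) : zeta n (diag g x) (diag h x) <-> (g (^) h < 2 ^ n)%N.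
Proof.
split=> [[k [kn]]|ghn].
  by rewrite diag_diag => /diag_free ->; rewrite lxorC lxorK.
by exists (g (^) h)%N; rewrite diag_diag lxorAC Nat.lxor_nilpotent Nat.lxor_0_l.
Qed.

Lemma zeta_sym n (x y : Xm) : zeta n x y -> zeta n y x.
Proof. by move=> [g [gn ->]]; exists g; rewrite diagK. Qed.

Lemma zeta_trans n (x y z : Xm) : zeta n x y -> zeta n y z -> zeta n x z.
Proof.
move=> [g [gn ->]] [h [hn ->]]; exists (h (^) g)%N; rewrite diag_diag.
by split=> //; exact: lxor_ltn_exp2.
Qed.

Lemma zeta_class n (x y : Xm) : zeta n x y -> zeta n y = zeta n x.
Proof. by move=> xy; apply/seteqP; split=> z; apply: zeta_trans => //; exact: zeta_sym. Qed.

Lemma zeta_leq j n (x y : Xm) : (j <= n)%N -> zeta j x y -> zeta n x y.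
Proof.
by move=> jn [g [gj ->]]; apply: zeta_diag; apply: leq_trans gj _; rewrite leq_exp2l.
Qed.

Lemma fsum_zeta (V : zmodType) n (x : Xm) (F : Xm -> V) :
  \sum_(z \in zeta n x) F z = \sum_(g < 2 ^ n) F (diag g x).
Proof.
rewrite (fsbig_ord _ _ (fun g => F (diag g x))).
rewrite -(fsbig_image `I_(2 ^ n) (diag^~ x)) /=; last by move=> g h _ _; exact: diag_free.
by apply: eq_fsbigl; apply/seteqP; split=> z [g] => [[gn ->]|gn <-]; exists g.
Qed.

Definition cylinder_code (N : nat) (x : Xm) : seq bool * seq bool :=
  (mkseq x.1 (2 ^ N), mkseq x.2 N).

Lemma eq_mkseqP (T : eqType) (u v : nat -> T) n :
  mkseq u n = mkseq v n <-> forall i, (i < n)%N -> u i = v i.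
Proof.
split=> [/eq_in_map uv i ltin|uv]; first by apply: uv; rewrite mem_iota.
by apply/eq_in_map => i; rewrite mem_iota; exact: uv.
Qed.

Lemma cylinder_codeP N x y : cylinder_code N x = cylinder_code N y <->
  (forall k, (k < 2 ^ N)%N -> x.1 k = y.1 k) /\ (forall i, (i < N)%N -> x.2 i = y.2 i).
Proof. by split=> [[/eq_mkseqP ? /eq_mkseqP]|[/eq_mkseqP e1 /eq_mkseqP e2]]; [|congr (_, _)]. Qed.

Lemma cylinder_code_refines N x y :
  cylinder_code N.+1 x = cylinder_code N.+1 y -> cylinder_code N x = cylinder_code N y.
Proof.
move=> /cylinder_codeP[xy1 xy2]; apply/cylinder_codeP; split=> [k kN|i iN].
  exact/xy1/ltn_exp2S.
by apply: xy2; exact: ltnW.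
Qed.

Lemma cylinder_code_separates x y :
  (forall N, cylinder_code N x = cylinder_code N y) -> x = y.
Proof.
move=> xy; rewrite (surjective_pairing x) (surjective_pairing y).
congr (_, _); apply/funext => k; have /cylinder_codeP[xy1 xy2] := xy k.+1.
  by apply/xy1/(ltn_trans _ (ltn_expl _ _)).
exact: xy2.
Qed.

Lemma measurable_config k b : measurable [set x : Xm | x.1 k = b].
Proof. by apply: sub_sigma_algebra; left; exists k, b. Qed.

Lemma measurable_digit i b : measurable [set x : Xm | x.2 i = b].
Proof. by apply: sub_sigma_algebra; right; exists i, b. Qed.

Lemma measurable_mkseq {d : measure_display} {T : measurableType d} (u : T -> nat -> bool) n s :
  (forall i b, measurable [set x | u x i = b]) -> measurable [set x | mkseq (u x) n = s].
Proof.
move=> mu; have [sn|/eqP sn] := eqVneq (size s) n; last first.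
  by rewrite (_ : mkset _ = set0) // -subset0 => x /(congr1 size); rewrite size_mkseq => /esym.
rewrite (_ : mkset _ = \bigcap_(i in `I_n) [set x | u x i = nth false s i]).
  exact: bigcap_measurableType.
apply/seteqP; split=> x /= => [<- i /= ltin|xs]; first by rewrite nth_mkseq.
rewrite -(mkseq_nth false s) sn; apply/eq_mkseqP => i; exact: xs.
Qed.

Lemma measurable_cylinder_code N s : measurable [set x | cylinder_code N x = s].
Proof.
rewrite (_ : mkset _ =
    [set x : Xm | mkseq x.1 (2 ^ N) = s.1] `&` [set x : Xm | mkseq x.2 N = s.2]).
  apply: measurableI; apply: measurable_mkseq; first exact: measurable_config.
  exact: measurable_digit.
by apply/seteqP; split=> x /= => [<-//|[]]; case: s => s1 s2 /= <- <-.
Qed.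

Lemma cylinder_code_diag n g x y : (g < 2 ^ n)%N ->
  cylinder_code n x = cylinder_code n y -> cylinder_code n (diag g x) = cylinder_code n (diag g y).
Proof.
move=> gn /cylinder_codeP[xy1 xy2]; apply/cylinder_codeP; split=> [k kn|i ltin] /=.
  exact/xy1/lxor_ltn_exp2.
by rewrite xy2.
Qed.

(* The point of the [zeta n]-class of [x] whose digits below [n] vanish. *)
Definition normal_form n (x : Xm) : Xm := diag (nat_of_bits x.2 n) x.

Lemma zeta_normal_form n x : zeta n x (normal_form n x).
Proof. by apply: zeta_diag; exact: nat_of_bits_ltn. Qed.

Lemma normal_form_zeta n x y : zeta n x y -> normal_form n x = normal_form n y.
Proof.
by move=> [g [gn ->]]; rewrite /normal_form diag_diag (nat_of_bits_diag _ gn) lxorK.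
Qed.

Lemma normal_form_digit n x i : (i < n)%N -> (normal_form n x).2 i = false.
Proof. by move=> ltin; rewrite /= testbit_nat_of_bits ltin /=; case: (x.2 i). Qed.

Lemma normal_form_code n x y : cylinder_code n x = cylinder_code n y ->
  cylinder_code n (normal_form n x) = cylinder_code n (normal_form n y).
Proof.
move=> xy; have /cylinder_codeP[_ xy2] := xy.
by rewrite /normal_form (eq_nat_of_bits xy2); apply: cylinder_code_diag (nat_of_bits_ltn _ _) _.
Qed.

Lemma config_tree_code n x y :
  cylinder_code n x = cylinder_code n y -> config_tree n x.1 = config_tree n y.1.
Proof. by move=> /cylinder_codeP[xy1 _]; exact/config_tree_eqP. Qed.

Lemma measurable_config_seq (K : seq nat) (f : nat -> bool) :
  measurable [set x : Xm | forall k, k \in K -> x.1 k = f k].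
Proof.
rewrite (_ : mkset _ = \bigcap_(k in [set k | k \in K]) [set x : Xm | x.1 k = f k]) //.
by apply: bigcap_measurableType => k _; exact: measurable_config.
Qed.

Lemma measurable_config_tree n (B : set (OP n)) :
  measurable [set x : Xm | B (config_tree n x.1)].
Proof.
apply: (measurable_code_invariant measurable_cylinder_code (N := n)) => x y xy /=.
by rewrite (config_tree_code xy).
Qed.

(* An isomorphism of the trees of cosets of two [zeta n]-classes, read on [D_n]. *)
Lemma zeta_bij_dyadic_isometry n (x y : Xm) (s : Xm -> Xm) :
  set_bij (zeta n x) (zeta n y) s ->
  (forall j, (j < n)%N -> forall z, zeta n x z -> s @` zeta j z = zeta j (s z)) ->
  exists2 phi, dyadic_isometry n phi &
    forall g, (g < 2 ^ n)%N -> (phi g < 2 ^ n)%N /\ s (diag g x) = diag (phi g) y.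
Proof.
move=> [maps inj_s _] sS.
have s_diag g : exists k, (g < 2 ^ n)%N -> (k < 2 ^ n)%N /\ s (diag g x) = diag k y.
  have [gn|] := boolP (g < 2 ^ n)%N; last by exists 0%N.
  by have [k [kn ->]] := maps _ (zeta_diag x gn); exists k.
have [phi phiP] := choice s_diag; exists phi => // j g h.
rewrite leq_eqVlt => /predU1P[->|jn] gn hn.
  by rewrite !lxor_ltn_exp2 //; [case: (phiP g gn) | case: (phiP h hn)].
have [_ sg] := phiP g gn; have [_ sh] := phiP h hn.
have imE : s @` zeta j (diag g x) = zeta j (s (diag g x)) by apply: sS => //; exact: zeta_diag.
apply/idP/idP => /zeta_diag2; last first.
  by move=> /(_ x) gh; apply/(zeta_diag2 _ _ _ y); rewrite -sg -sh -imE; exists (diag h x).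
move=> /(_ y); rewrite -sg -sh -imE => -[z gz /inj_s]; rewrite !inE => zh.
apply/(zeta_diag2 _ _ _ x); rewrite -zh //; last exact: zeta_diag.
exact: zeta_trans (zeta_diag x gn) (zeta_leq (ltnW jn) gz).
Qed.

Section KantorovichBounds.
Variables (R : realType) (rho : Xm -> Xm -> R).

Lemma Kant_zeta_ge n x y :
  (forall z t : Xm, (z.1 0 != t.1 0)%:R <= rho z t) ->
  (((2 ^+ n)^-1 * (tdist (config_tree n x.1) (config_tree n y.1))%:R)%:E <=
     Kant zeta rho n x y)%E.
Proof.
move=> rho_ge; apply: le_ereal_inf_tmp => _ [s [bij_s sS] <-].
have [phi iso_phi phiP] := zeta_bij_dyadic_isometry bij_s sS.
have [phi0 _] := phiP 0%N (expn_gt0 2 n).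
rewrite lee_fin ler_pM2l ?invr_gt0 ?exprn_gt0 // fsum_zeta -(tdist_shift _ _ phi0).
apply: (@le_trans _ _ (\sum_(g < 2 ^ n) (x.1 g != y.1 (phi g)))%N%:R).
  by rewrite ler_nat; exact: tdist_le_mismatch.
rewrite natr_sum; apply: ler_sum => g _; have [_ ->] := phiP g (ltn_ord g).
by apply: le_trans (rho_ge _ _); rewrite /= !Nat.lxor_0_l.
Qed.

Lemma Kant_zeta_class n x x' y y' : zeta n x x' -> zeta n y y' ->
  Kant zeta rho n x' y' = Kant zeta rho n x y.
Proof. by move=> xx' yy'; rewrite /Kant (zeta_class xx') (zeta_class yy'). Qed.

(* The equivariant bijection of the classes that sends [x] to [y]. *)
Lemma Kant_zeta_aligned_le n x y (e : R) :
  (forall z t, cylinder_code n z = cylinder_code n t -> rho z t <= e) ->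
  cylinder_code n x = cylinder_code n y -> (Kant zeta rho n x y <= e%:E)%E.
Proof.
move=> rho_le xy.
pose s (z : Xm) := diag (nat_of_bits (fun i => xorb (z.2 i) (x.2 i)) n) y.
have s_diag g : (g < 2 ^ n)%N -> s (diag g x) = diag g y.
  move=> gn; rewrite /s -[in RHS](nat_of_testbit gn); congr diag; apply: eq_nat_of_bits => i _ /=.
  by case: (x.2 i) (Nat.testbit g i) => [] [].
apply: ge_ereal_inf; exists ((2 ^+ n)^-1 * \sum_(z \in zeta n x) rho z (s z))%:E; last first.
  rewrite lee_fin fsum_zeta mulrC ler_pdivrMr ?exprn_gt0 //.
  apply: (@le_trans _ _ (\sum_(g < 2 ^ n) e)).
    by apply: ler_sum => g _; rewrite s_diag //; apply/rho_le/cylinder_code_diag.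
  by rewrite sumr_const card_ord -natrX mulr_natr.
exists s => //; split; first split.
- by move=> _ [g [gn ->]]; rewrite s_diag //; exact: zeta_diag.
- move=> _ _ /set_mem[g [gn ->]] /set_mem[h [hn ->]].
  by rewrite !s_diag // => /diag_free ->.
- by move=> _ [g [gn ->]]; exists (diag g x); [exact: zeta_diag | exact: s_diag].
move=> j jn _ [g [gn ->]]; rewrite s_diag //.
have s_diag2 h : (h < 2 ^ j)%N -> s (diag h (diag g x)) = diag h (diag g y).
  move=> hj; rewrite !diag_diag s_diag //; apply: lxor_ltn_exp2 => //.
  by apply: leq_trans hj _; rewrite leq_exp2l // ltnW.
apply/seteqP; split=> [_ [_ [h [hj ->]] <-]|_ [h [hj ->]]].
  by rewrite s_diag2 //; exact: zeta_diag.
by exists (diag h (diag g x)); [exact: zeta_diag | exact: s_diag2].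
Qed.

Lemma Kant_zeta_normal_form_le n x y (e : R) :
  (forall z t, cylinder_code n z = cylinder_code n t -> rho z t <= e) ->
  config_tree n (normal_form n x).1 = config_tree n (normal_form n y).1 ->
  (Kant zeta rho n x y <= e%:E)%E.
Proof.
move=> rho_le /config_tree_eqP xy.
rewrite -(Kant_zeta_class (zeta_normal_form n x) (zeta_normal_form n y)).
apply: Kant_zeta_aligned_le => //; apply/cylinder_codeP; split=> // i ltin.
by rewrite !normal_form_digit.
Qed.

End KantorovichBounds.

(** * Scaling of the orbit filtration *)

Lemma code_dist_config (R : realType) (x y : Xm) :
  (x.1 0 != y.1 0)%:R <= code_dist R cylinder_code x y.
Proof.
have [_|xy] := eqVneq (x.1 0) (y.1 0); first exact: code_dist_ge0.
have := @code_dist_ge _ _ R _ cylinder_code 0 x y; rewrite expr0 invr1; apply.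
by move=> /cylinder_codeP[xy0 _]; case/eqP: xy; exact: xy0.
Qed.

Section OrbitScaling.
Variables (R : realType) (sigma : nat -> bool) (P : probability Xm R).
Hypothesis omegaP : omega_sigma sigma P.

Local Notation ones := (ones sigma).
Local Notation rho := (code_dist R cylinder_code).

Lemma omega_config (K : seq nat) (f : nat -> bool) :
  P [set x : Xm | forall k, k \in K -> x.1 k = f k] =
  if `[< forall k k', k \in K -> k' \in K -> same_coset sigma k k' -> f k = f k' >]
  then ((2 ^+ size (undup (map (coset_key sigma) K)))^-1)%:E else 0%E.
Proof.
rewrite -[size _]addn0 -(omegaP K [::] f xpredT); congr (P _).
by apply/seteqP; split=> x /= => [|[]].
Qed.

Lemma config_constant_on_coset k k' : same_coset sigma k k' ->
  {ae P, forall x : Xm, x.1 k = x.1 k'}.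
Proof.
move=> kk'; have [->|neq] := eqVneq k k'; first exact: aeW.
have k'k : (k' == k) = false by rewrite eq_sym (negbTE neq).
pose cyl b := [set x : Xm | forall j, j \in [:: k; k'] -> x.1 j = (b == (j == k))].
apply: (@negligibleS _ _ _ _ (cyl true `|` cyl false)).
  move=> x /= xkk'; case xk : (x.1 k) xkk' => xkk'; [left|right] => j;
    rewrite !inE => /orP[] /eqP ->; rewrite ?eqxx // k'k;
    by case: (x.1 k') xkk'.
suff cyl0 b : P.-negligible (cyl b) by apply: negligibleU.
apply/negligibleP; first exact: measurable_config_seq.
apply: etrans (omega_config _ _) _; case: asboolP => // /(_ k k').
rewrite !inE !eqxx orbT => /(_ isT isT kk').
by rewrite k'k; case: b.
Qed.

Lemma invariant_config_ae : {ae P, forall x : Xm, invariant_config sigma x.1}.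
Proof.
have : {ae P, forall x : Xm, forall i k, sigma i = false -> x.1 k = x.1 (k (^) 2 ^ i)%N}.
  apply: ae_foralln => i; apply: ae_foralln => k.
  have [si|/negbTE si] := boolP (sigma i); first exact: aeW.
  by have := config_constant_on_coset (same_coset_exp2 (k := k) si); apply: filterS.
by apply: filterS => x inv i si; apply/funext => k; rewrite /shift -inv.
Qed.

Lemma config_tree_mass n (v : OP n) :
  (P [set x : Xm | config_tree n x.1 = v] <= ((2 ^+ (2 ^ ones n))^-1)%:E)%E.
Proof.
rewrite (_ : mkset _ = [set x : Xm | forall k, k \in iota 0 (2 ^ n) -> x.1 k = Phi v k]).
  by rewrite omega_config size_undup_coset_key; case: ifP.
apply/seteqP; split=> x /= => [<- k|xv].
  by rewrite mem_iota => kn; rewrite Phi_config_tree.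
rewrite -(config_treeK v); apply/config_tree_eqP => k kn.
by apply: xv; rewrite mem_iota.
Qed.

Lemma config_tree_set_mass n (B : {set OP n}) :
  (P [set x : Xm | config_tree n x.1 \in B] <= (#|B|%:R / 2 ^+ (2 ^ ones n))%:E)%E.
Proof.
apply: (@le_trans _ _ (\sum_(v <- enum B) P [set x : Xm | config_tree n x.1 = v])%E).
  rewrite fsbig_seq ?enum_uniq //; apply: content_sub_fsum => //.
  - by move=> v _; exact: (measurable_config_tree [set v]).
  - exact: (measurable_config_tree [set` B]).
  - by move=> x /= xB; exists (config_tree n x.1); rewrite /= ?mem_enum.
apply: (@le_trans _ _ (\sum_(v <- enum B) ((2 ^+ (2 ^ ones n))^-1)%:E)%E).
  by apply: lee_sum => v _; exact: config_tree_mass.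
by rewrite sumEFin lee_fin big_enum sumr_const mulr_natl.
Qed.

Lemma small_diam_tball n (Y : set Xm) : (Kdiam zeta rho n Y < (1 / 64)%:E)%E ->
  exists u : OP (ones n), forall x, Y x -> invariant_config sigma x.1 ->
    config_tree n x.1 \in [set tree_expand v | v in tball u]%SET.
Proof.
move=> diamY.
have [[x0 [Yx0 inv0]]|none] := pselect (exists x, Y x /\ invariant_config sigma x.1); last first.
  by exists (config_tree _ xpredT) => x Yx inv; case: none; exists x.
have [u0 eu0] := config_tree_invariant n inv0; exists u0 => x Yx inv.
have [u eu] := config_tree_invariant n inv; rewrite eu; apply: imset_f; rewrite inE.
have Kant_lt : (Kant zeta rho n x0 x < (1 / 64)%:E)%E.
  by apply: le_lt_trans diamY; apply: ereal_sup_ubound; exists x0, x.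
have := le_lt_trans (Kant_zeta_ge n x0 x (@code_dist_config R)) Kant_lt.
rewrite eu0 eu lte_fin mulrC ltr_pdivrMr ?exprn_gt0 // => dist_lt.
rewrite -(ltn_pmul2l (expn_gt0 2 n)) mulnCA -tdist_tree_expand mulnCA.
rewrite [(2 ^ n * 2 ^ _)%N]mulnC ltn_pmul2l ?expn_gt0 // -(ltr_nat R).
by rewrite natrM natrX; lra.
Qed.

Lemma small_diam_mass n (Y : set Xm) :
  measurable Y -> (Kdiam zeta rho n Y < (1 / 64)%:E)%E ->
  (P Y <= ((11 / 16) ^+ (2 ^ ones n %/ 4) / 2)%:E)%E.
Proof.
move=> mY /small_diam_tball[u ball_u]; set B := [set tree_expand v | v in tball u]%SET in ball_u.
have [N [mN PN sub_N]] := invariant_config_ae.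
have mB : measurable [set x : Xm | config_tree n x.1 \in B].
  exact: (measurable_config_tree [set` B]).
apply: (@le_trans _ _ (P (N `|` [set x : Xm | config_tree n x.1 \in B]))).
  apply: le_measure; rewrite ?inE //; first exact: measurableU.
  move=> x Yx; have [inv|] := pselect (invariant_config sigma x.1).
    by right; exact: ball_u.
  by left; apply: sub_N.
apply: le_trans (measureU2 _ _ _) _ => //; rewrite [X in (X + _)%E](_ : _ = 0%E) // add0e.
apply: le_trans (config_tree_set_mass B) _; rewrite lee_fin ler_pdivrMr ?exprn_gt0 //.
have : #|B|%:R <= #|tball u|%:R :> R by rewrite ler_nat leq_imset_card.
by have := card_tball R u; lra.
Qed.

Lemma eps_partition_card_ge n k (eps : R) : eps < 1 / 64 ->
  eps_partition P zeta rho eps n k -> (16 / 11) ^+ (2 ^ ones n %/ 4).+1 <= k%:R :> R.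
Proof.
move=> eps64 part; set q := (2 ^ ones n %/ 4)%N.
pose a : R := (11 / 16) ^+ q; pose b : R := (16 / 11) ^+ q.
have b0 : 0 < b by rewrite exprn_gt0 //; lra.
have ab : a * b = 1 by rewrite -exprMn (_ : _ * _ = 1) ?expr1n //; lra.
have mass : 1 <= eps + k%:R * (a / 2).
  apply: eps_partition_mass part _ => Y mY diamY; apply: small_diam_mass => //.
  by apply: lt_trans diamY _; rewrite lte_fin.
have : b * 1 <= b * (eps + k%:R * (a / 2)) by rewrite ler_pM2l.
have -> : b * (eps + k%:R * (a / 2)) = b * eps + k%:R / 2 * (a * b) by ring.
have : b * eps <= b * (1 / 64) by rewrite ler_pM2l // ltW.
by rewrite ab exprS -/b; lra.
Qed.

Lemma eps_partition_zeta n (eps : R) : (2 ^+ n)^-1 < eps ->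
  eps_partition P zeta rho eps n (2 ^ 2 ^ ones n).
Proof.
move=> eps_n; rewrite -card_OP.
pose label (x : Xm) := [pick u | config_tree n (normal_form n x).1 == @tree_expand sigma n u].
have labelP x u : label x = Some u -> config_tree n (normal_form n x).1 = tree_expand u.
  by rewrite /label; case: pickP => // v /eqP ? [<-].
have label_code x y : cylinder_code n x = cylinder_code n y -> label x = label y.
  by rewrite /label => /normal_form_code/config_tree_code ->.
have mlabel l : measurable (label @^-1` [set l]).
  apply: (measurable_code_invariant measurable_cylinder_code (N := n)) => x y xy /=.
  by rewrite (label_code _ _ xy).
apply: (eps_partition_label (label := label) eps_n) => //.
- by move=> x y /normal_form_zeta xy; rewrite /label xy.
- rewrite measure_negligible ?lte_fin //.
    by rewrite (lt_trans _ eps_n) // invr_gt0 exprn_gt0.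
  apply: negligibleS invariant_config_ae => x /=; rewrite /label; case: pickP => // none _ inv.
  have [u eu] := config_tree_invariant n (invariant_config_shift (nat_of_bits x.2 n) inv).
  by have /eqP[] := none u.
move=> x y u /labelP xu /labelP yu; apply: Kant_zeta_normal_form_le; last by rewrite xu.
by move=> z t; exact: (code_dist_le R cylinder_code_refines).
Qed.

Lemma entropy_zeta_ge n (eps : R) : eps < 1 / 64 ->
  ((ln (16 / 11) / 4 / ln 2 * 2 ^+ ones n)%:E <= entropy P zeta rho eps n)%E.
Proof.
move=> eps64.
have c0 : 0 < (16 / 11 : R) by lra.
apply: le_trans (entropy_ge (exprn_gt0 _ c0) (fun k => @eps_partition_card_ge n k eps eps64)).
rewrite lee_fin mulrAC ler_pM2r ?invr_gt0 ?ln2_gt0 // lnXn // -[leRHS]mulr_natl.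
have size_le : 2 ^+ ones n <= 4 * (2 ^ ones n %/ 4).+1%:R :> R.
  by rewrite -natrX -natrM ler_nat mulnC ltnW // ltn_ceil.
have ln1611 : 0 < ln (16 / 11) :> R by apply: ln_gt0; lra.
by have := ler_wpM2l (ltW ln1611) size_le; lra.
Qed.

Lemma entropy_zeta_le n (eps : R) : (2 ^+ n)^-1 < eps ->
  (entropy P zeta rho eps n <= (1 * 2 ^+ ones n)%:E)%E.
Proof.
move=> eps_n; apply: le_trans (entropy_le (eps_partition_zeta eps_n)) _.
by rewrite lee_fin natrX lnXn // -[X in X / _]mulr_natr mulrAC mulfV ?gt_eqF ?ln2_gt0 // natrX.
Qed.

Theorem scaling_sequence_zeta :
  scaling_sequence P zeta (fun n => 2%:R ^+ (\sum_(i < n) sigma i)%N).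
Proof.
under [X in scaling_sequence _ _ X]eq_fun do rewrite sum_ones.
exists rho; split.
  exact: (code_dist_admissible cylinder_code_refines cylinder_code_separates
            measurable_cylinder_code).
exists (1 / 64); split=> [|eps /andP[eps0 eps64]]; first lra.
apply: (asymp_bounds (c := ln (16 / 11) / 4 / ln 2) (C := 1)).
- by rewrite !divr_gt0 ?ln2_gt0 ?ln_gt0 //; lra.
- by move=> n; rewrite exprn_gt0.
- by apply: nearW => n; exact: entropy_zeta_ge.
apply: filterS (near_infty_natSinv_expn_lt (PosNum eps0)) => n /=; rewrite div1r.
exact: entropy_zeta_le.
Qed.

End OrbitScaling.

(** * The path space *)

Lemma TOP_eq (x y : TOP) : (forall n, tv x n = tv y n) -> te x =1 te y -> x = y.
Proof.
case: x y => [v e p] [v' e' p'] /= vv' /funext ee'; subst e'.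
have vE : v = v' by apply: functional_extensionality_dep.
by subst v'; congr mkTOP; exact: Prop_irrelevance.
Qed.

Lemma config_tree_path (w a : nat -> bool) n :
  config_tree n (shift (nat_of_bits a n) w) =
  if a n then (config_tree n.+1 (shift (nat_of_bits a n.+1) w)).2
  else (config_tree n.+1 (shift (nat_of_bits a n.+1) w)).1.
Proof.
rewrite nat_of_bitsS; case: (a n) => /=; last by rewrite Nat.lxor_0_r.
by rewrite shift_shift lxorC lxorK.
Qed.

Definition path_of (z : Xm) : Tm :=
  @mkTOP (fun n => config_tree n (normal_form n z).1) z.2 (config_tree_path z.1 z.2).

Lemma path_ofK : cancel path_of Psi.
Proof.
move=> z; rewrite [RHS]surjective_pairing; congr (_, _); apply/funext => g.
rewrite /= Phi_config_tree /shift ?lxorK //.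
by apply: lxor_ltn_exp2; [exact: ltn_expl | exact: nat_of_bits_ltn].
Qed.

Lemma Phi_tvS (x : TOP) n h : (h < 2 ^ n)%N ->
  Phi (tv x n.+1) (h (^) nat_of_bits (te x) n.+1) = Phi (tv x n) (h (^) nat_of_bits (te x) n).
Proof.
move=> hn; have bits_n := lxor_ltn_exp2 hn (nat_of_bits_ltn (te x) n).
rewrite [tv x n]tpath nat_of_bitsS lxorA; case: (te x n).
  by rewrite Phi_snd.
by rewrite Nat.lxor_0_r Phi_fst.
Qed.

Lemma Phi_tv_leq (x : TOP) n m h : (n <= m)%N -> (h < 2 ^ n)%N ->
  Phi (tv x m) (h (^) nat_of_bits (te x) m) = Phi (tv x n) (h (^) nat_of_bits (te x) n).
Proof.
move=> /subnK <- hn; elim: (m - n)%N => // k IH; rewrite addSn Phi_tvS //.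
by apply: leq_trans hn _; rewrite leq_exp2l // leq_addl.
Qed.

Lemma Psi_config (x : Tm) n h : (h < 2 ^ n)%N ->
  (Psi x).1 h = Phi (tv x n) (h (^) nat_of_bits (te x) n).
Proof.
move=> hn; rewrite /= -[tshift x h]/(nat_of_bits (te x) h).
have [h_le_n|/ltnW n_le_h] := leqP h n; last exact: Phi_tv_leq.
by rewrite -(Phi_tv_leq x h_le_n) // ltn_expl.
Qed.

Lemma tv_Psi (x : Tm) n : tv x n = config_tree n (normal_form n (Psi x)).1.
Proof.
apply: Phi_inj => h hn; rewrite Phi_config_tree //.
have bits_n := lxor_ltn_exp2 hn (nat_of_bits_ltn (te x) n).
by rewrite -[RHS]/((Psi x).1 _) (Psi_config _ bits_n) lxorK.
Qed.

Lemma PsiK : cancel Psi path_of.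
Proof. by move=> x; apply: TOP_eq => // n; rewrite (tv_Psi x). Qed.

Lemma xi_zeta n (x y : Tm) : xi n x y <-> zeta n (Psi x) (Psi y).
Proof.
split=> [[tv_eq te_eq]|[g [gn Psiy]]]; last first.
  have te_y i : te y i = xorb (te x i) (Nat.testbit g i) by exact: (congr1 (fun z => z.2 i) Psiy).
  split=> m nm; last by rewrite te_y (testbit_above gn nm) Bool.xorb_false_r.
  rewrite !tv_Psi; congr (config_tree _ _.1); apply: normal_form_zeta.
  by rewrite Psiy; apply: zeta_diag; apply: leq_trans gn _; rewrite leq_exp2l.
pose g := (nat_of_bits (te x) n (^) nat_of_bits (te y) n)%N.
have gn : (g < 2 ^ n)%N by apply: lxor_ltn_exp2; exact: nat_of_bits_ltn.
have te_y : te y = (diag g (Psi x)).2.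
  apply/funext => i; rewrite /= Nat.lxor_spec !testbit_nat_of_bits.
  by case: ltnP => [_|/te_eq ->] /=; [case: (te x i) (te y i) => [] [] | case: (te y i)].
exists g; split=> //; rewrite [LHS]surjective_pairing; congr (_, _); last exact: te_y.
apply/funext => k; pose m := (n + k)%N.
have gm : (g < 2 ^ m)%N by apply: leq_trans gn _; rewrite leq_exp2l // leq_addr.
have km : (k < 2 ^ m)%N.
  by apply: leq_trans (ltn_expl k (isT : 1 < 2)%N) _; rewrite leq_exp2l // leq_addl.
rewrite (Psi_config _ km) -(tv_eq _ (leq_addr k n)) te_y nat_of_bits_diag //.
by rewrite [RHS](Psi_config _ (lxor_ltn_exp2 km gm)) -lxorA (lxorC g).
Qed.

Lemma measurable_te i b : measurable [set x : Tm | te x i = b].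
Proof. by apply: sub_sigma_algebra; right; exists i, b. Qed.

Lemma measurable_tv n (B : set (OP n)) : measurable [set x : Tm | B (tv x n)].
Proof.
rewrite (_ : mkset _ = \bigcup_(v in B) [set x : Tm | tv x n = v]).
  by apply: fin_bigcup_measurable => // v _; apply: sub_sigma_algebra; left; exists n, v.
by apply/seteqP; split=> [x Bx|x [v Bv /= ->] //]; exists (tv x n).
Qed.

Lemma measurable_Psi : measurable_fun setT (Psi : Tm -> Xm).
Proof.
apply: (@measurability _ _ Tm Xm setT Psi GX erefl).
move=> _ [_ [[k [b ->]]|[i [b ->]]] <-]; rewrite setTI; last exact: measurable_te.
rewrite (_ : _ @^-1` _ = \bigcup_s ([set x : Tm | mkseq (te x) k = s] `&`
    [set x : Tm | Phi (tv x k) (k (^) nat_of_bits (nth false s) k) = b])).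
  apply: countable_bigcupT_measurable => // s; apply: measurableI.
    exact: measurable_mkseq measurable_te.
  exact: (@measurable_tv k [set v | Phi v (k (^) nat_of_bits (nth false s) k) = b]).
have mkseqK x : nat_of_bits (nth false (mkseq (te x) k)) k = tshift x k.
  by apply: eq_nat_of_bits => i ik; rewrite nth_mkseq.
apply/seteqP; split=> x /=; last by move=> [s _ [<-]] /=; rewrite mkseqK.
by exists (mkseq (te x) k) => //=; rewrite mkseqK.
Qed.

Lemma measurable_path_of : measurable_fun setT path_of.
Proof.
apply: (@measurability _ _ Xm Tm setT path_of GT erefl).
move=> _ [_ [[n [v ->]]|[i [b ->]]] <-]; rewrite setTI; last exact: measurable_digit.
apply: (measurable_code_invariant measurable_cylinder_code (N := n)) => z t zt <-.
exact/esym/config_tree_code/normal_form_code.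
Qed.

Lemma path_of_iso (R : realType) (P : probability Xm R) (Q : probability Tm R) :
  (forall B : set Tm, measurable B -> Q B = P (Psi @` B)) ->
  filtration_iso P Q zeta xi path_of Psi.
Proof.
move=> QE; split; [exact: path_ofK | exact: PsiK | exact: measurable_path_of
  | exact: measurable_Psi | by move=> n z t; rewrite xi_zeta !path_ofK |].
move=> B mB; rewrite QE //; congr (P _); apply/seteqP; split=> [_ [x Bx <-]|z Bz].
  by rewrite /= PsiK.
by exists (path_of z); rewrite ?path_ofK.
Qed.

Theorem theorem9 (R : realType) (sigma : nat -> bool)
    (P : probability Xm R) (Q : probability Tm R) :
  omega_sigma sigma P ->
  (forall B : set Tm, measurable B -> Q B = P (Psi @` B)) ->
  scaling_sequence P zeta (fun n => 2%:R ^+ (\sum_(i < n) sigma i)%N) /\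
  scaling_sequence Q xi (fun n => 2%:R ^+ (\sum_(i < n) sigma i)%N).
Proof.
move=> omegaP QE; have zeta_scaling := scaling_sequence_zeta omegaP.
split; first exact: zeta_scaling.
exact: (iso_scaling_sequence (path_of_iso QE) zeta_scaling).
Qed.
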